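(* Let $G=(V,E)$ be a directed acyclic graph with no active cycle and let $v_1,v_2\in V$ with $v_1\to v_2\in E$. Suppose $v_1\leftarrow x_1\sim\cdots\sim x_n\sim v_2$ is a trail activated by the empty set whose first arc is $x_1\to v_1$, with $n\ge1$, and which has the minimum number of nodes among all trails between $v_1$ and $v_2$ activated by the empty set whose first arc points into $v_1$. Then, with the convention $x_{n+1}:=v_2$, we have $x_i\to x_{i+1}\in E$ for all $i\in\{1,\dots,n\}$ and $v_1\to x_i\in E$ for all $i\in\{2,\dots,n\}$. Furthermore, the same conclusion holds if the trail $v_1\leftarrow x_1\sim\cdots\sim x_n\to v_2$, $n\ge1$, has instead the minimum number of nodes among all trails between $v_1$ and $v_2$ activated by the empty set whose first arc points into $v_1$ and whose last arc points into $v_2$.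
   Context: Graphs are finite, simple, without loops. A trail is a sequence of pairwise distinct nodes with consecutive nodes adjacent (arc in either direction), written $v_1\sim\cdots\sim v_n$, with $\to$/$\leftarrow$ indicating a known direction. An interior node $v_j$ is a converging connection if $v_{j-1}\to v_j\leftarrow v_{j+1}$, otherwise serial or diverging. A trail is activated by the empty set iff it has no converging connection. $G$ contains an active cycle if there exist a node $v$, distinct parents $w,z$ of $v$, and a trail $w\sim y_1\sim\cdots\sim y_m\sim z$ with $m\ge1$ all of whose interior nodes are serial or diverging connections, such that the cycle $v,w,y_1,\dots,y_m,z$ has no arc of $G$ between two of its nodes that are not consecutive in this cyclic order. *)

(* Defs.v *)
From mathcomp Require Import all_boot.

Set Implicit Arguments.
Unset Strict Implicit.
Unset Printing Implicit Defensive.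

Section Digraph.

Variables (V : finType) (E : rel V).

(* [cycle E [:: x]] is [E x x], so loops and 2-cycles are excluded too. *)
Definition acyclic : Prop :=
  forall c : seq V, c != [::] -> ~~ cycle E c.

Definition adjacent : rel V := [rel x y | E x y || E y x].

Definition is_trail (s : seq V) : bool := uniq s && sorted adjacent s.

Definition converging (a b c : V) : bool := E a b && E c b.

(* [infix [:: a; b; c] s] says that a, b, c are consecutive in s, so b runs
   over the interior nodes of s. *)
Definition empty_activated (s : seq V) : Prop :=
  forall a b c : V, infix [:: a; b; c] s -> ~~ converging a b c.

(* [next c] is the successor in the cyclic order of the sequence c. *)
Definition chordless (c : seq V) : Prop :=
  forall a b : V, a \in c -> b \in c -> E a b ->
    (b == next c a) || (a == next c b).

Definition has_active_cycle : Prop :=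
  exists (v w z : V) (y : seq V),
    [/\ w != z, E w v & E z v] /\
    [/\ y != [::],
        is_trail (w :: rcons y z),
        empty_activated (w :: rcons y z),
        uniq (v :: w :: rcons y z)
      & chordless (v :: w :: rcons y z)].

(* Trails between two distinct nodes u and w are given by their sequence y of
   interior nodes, the whole trail being [u :: rcons y w].  The defaults of
   [head w y] and [last u y] make these the second and the penultimate node of
   the trail even if y is empty. *)
Definition active_trail_into_start (u w : V) (y : seq V) : Prop :=
  [/\ is_trail (u :: rcons y w),
      empty_activated (u :: rcons y w)
    & E (head w y) u].

Definition active_trail_into_both (u w : V) (y : seq V) : Prop :=
  active_trail_into_start u w y /\ E (last u y) w.

(* The trail with interior x has [(size x).+2] nodes, so it is enough to
   compare the interiors. *)
Definition fewest_nodes (P : seq V -> Prop) (x : seq V) : Prop :=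
  P x /\ forall y : seq V, P y -> size x <= size y.

End Digraph.

(* Main.v *)
Require Import Defs.
From mathcomp Require Import all_boot zify.

Set Implicit Arguments.
Unset Strict Implicit.
Unset Printing Implicit Defensive.

(** Write the trail as X 0 = v1, ..., X n.+1 = v2.  Having no converging
    connection, it first goes up against the arcs to a node X k and then down
    along them; acyclicity and v1 -> v2 give 0 < k <= n, so the last arc always
    points into v2 and both minimality conditions are the same.  A chord of the
    trail yields a shorter active trail, except for chords v1 -> X j.  If
    v1 -> X l with 2 < l but v1 and X (l - 1) are not adjacent, let j < l - 1 be
    maximal with v1 and X j adjacent (j = 1 is a candidate): then X l, v1, X j,
    ..., X (l - 1) is an active cycle.  Hence, descending from l = n + 1, v1 is a
    parent of X 2, ..., X (n + 1); in particular X 2 is not above v1, so k = 1. *)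

(** * Trails as functions on natural numbers *)

Section Walks.

Variables (V : finType) (E : rel V).

Lemma adjacent_sym : symmetric (adjacent E).
Proof. by move=> a b; rewrite /adjacent /= orbC. Qed.

Lemma acyclic_connect (x y : V) : acyclic E -> connect E x y -> ~~ E y x.
Proof.
move=> acE /connectP[p xEp ->]; have /(_ isT) := acE (x :: p).
by rewrite /cycle rcons_path xEp.
Qed.

Lemma walk_connect (X : nat -> V) (a b : nat) :
  a <= b -> (forall i, a <= i < b -> E (X i) (X i.+1)) -> connect E (X a) (X b).
Proof.
elim: b => [|b IHb]; first by rewrite leqn0 => /eqP->.
rewrite leq_eqVlt => /predU1P[-> //|lt_ab] stepE.
apply: (@connect_trans _ _ (X b)); last by apply/connect1/stepE; lia.
by apply: IHb => // i le_i; apply: stepE; lia.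
Qed.

Lemma walk_connect_rev (X : nat -> V) (a b : nat) :
  a <= b -> (forall i, a <= i < b -> E (X i.+1) (X i)) -> connect E (X b) (X a).
Proof.
elim: b => [|b IHb]; first by rewrite leqn0 => /eqP->.
rewrite leq_eqVlt => /predU1P[-> //|lt_ab] stepE.
apply: (@connect_trans _ _ (X b)); first by apply/connect1/stepE; lia.
by apply: IHb => // i le_i; apply: stepE; lia.
Qed.

(** Only the values below [N] matter. Indexing by numbers turns cutting and rerouting a trail into
    composition with an index map. *)
Definition active_walk (X : nat -> V) (N : nat) : Prop :=
  [/\ {in gtn N &, injective X},
      forall i, i.+1 < N -> adjacent E (X i) (X i.+1)
    & forall i, i.+2 < N -> ~~ converging E (X i) (X i.+1) (X i.+2)].

Lemma active_walkP (X : nat -> V) (N : nat) :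
  is_trail E (mkseq X N) /\ empty_activated E (mkseq X N) <-> active_walk X N.
Proof.
rewrite /is_trail; split=> [[/andP[/mkseq_uniqP injX /(sortedP (X 0)) adjX] actX]
                          |[injX adjX actX]].
- split=> // i lt_iN.
    by have := adjX i; rewrite size_mkseq !nth_mkseq //; [apply|lia].
  (* The triple at [i] is isolated by cutting the index range into lengths [i], 3 and the rest. *)
  apply: actX; apply/infixP; exists (mkseq X i), (map X (iota i.+3 (N - i.+3))).
  by rewrite {1}(_ : N = i + (3 + (N - i.+3))) ?/mkseq; [rewrite iotaD map_cat|lia].
split; first (apply/andP; split); first exact/mkseq_uniqP.
  by apply/(sortedP (X 0)) => i; rewrite size_mkseq => ltN; rewrite !nth_mkseq ?adjX //; lia.
move=> a b c /infixP[s [t def_s]].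
have ltN : (size s).+2 < N.
  by have := congr1 size def_s; rewrite size_mkseq !size_cat /=; lia.
have nthX i : i < 3 -> X (size s + i) = nth a [:: a; b; c] i.
  move=> lt_i3; have := congr1 (nth a ^~ (size s + i)) def_s.
  rewrite nth_mkseq; last by lia.
  by rewrite !nth_cat ltnNge leq_addr addKn lt_i3.
have := actX _ ltN; have := (nthX 0 isT, nthX 1 isT, nthX 2 isT).
by rewrite addn0 addn1 addn2 /= => -[[-> ->] ->].
Qed.

Lemma mkseq_ends (X : nat -> V) (n : nat) :
  mkseq X n.+2 = X 0 :: rcons (mkseq (X \o S) n) (X n.+1).
Proof. by rewrite mkseqS /mkseq /= -[1]addn0 iotaDl -map_comp. Qed.

Lemma active_trail_into_start_walk (X : nat -> V) (n : nat) :
  active_trail_into_start E (X 0) (X n.+1) (mkseq (X \o S) n)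
    <-> active_walk X n.+2 /\ E (X 1) (X 0).
Proof.
rewrite /active_trail_into_start -mkseq_ends.
have -> : head (X n.+1) (mkseq (X \o S) n) = X 1 by case: n.
by split=> [[? ? ?]|[/active_walkP[? ?] ?]] //; split=> //; apply/active_walkP.
Qed.

(** * Chordless cycles, and the turning node of an active trail *)

Lemma chordless_mkseq (X : nat -> V) (N : nat) :
  {in gtn N &, injective X} ->
  (forall i, i < N -> ~~ E (X i) (X i)) ->
  (forall i j, i.+1 < j < N -> adjacent E (X i) (X j) -> i = 0 /\ j.+1 = N) ->
  chordless E (mkseq X N).
Proof.
move=> injX irrE chordX.
have nextX i : i < N ->
    next (mkseq X N) (X i) = if i.+1 < N then X i.+1 else X 0.
  move=> ltN; have uX : uniq (mkseq X N) by apply/mkseq_uniqP.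
  have nthXi : nth (X 0) (mkseq X N) i = X i by rewrite nth_mkseq.
  rewrite next_nth -nthXi mem_nth ?index_uniq ?size_mkseq //.
  case: N ltN {injX irrE chordX uX nthXi} => // N ltN.
  rewrite {1}/mkseq /=.
  have [lt_iN|le_Ni] := ltnP i.+1 N.+1.
    rewrite (nth_map 0) ?size_iota ?nth_iota //.
  by rewrite nth_default // size_map size_iota.
have wlogX i j : i < j < N -> adjacent E (X i) (X j) ->
    (X j == next (mkseq X N) (X i)) || (X i == next (mkseq X N) (X j)).
  move=> /andP[lt_ij ltN] /chordX chord_ij; rewrite !nextX; try lia.
  have [lt_i1j|le_ji1] := ltnP i.+1 j; last first.
    have -> : j = i.+1 by lia.
    by rewrite ifT ?eqxx //; lia.
  by have [|-> ->] := chord_ij; rewrite ?lt_i1j // ltnn eqxx orbT.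
move=> _ _ /mapP[i + ->] /mapP[j + ->]; rewrite !mem_iota /= => ltiN ltjN Eij.
have [lt_ij|lt_ji|eq_ij] := ltngtP i j.
- by apply: wlogX; rewrite /adjacent /= ?Eij //; lia.
- by rewrite orbC; apply: wlogX; rewrite /adjacent /= ?Eij ?orbT //; lia.
by move: Eij; rewrite eq_ij (negPf (irrE _ _)).
Qed.

(** [X 0] is the common child, [X 1] and [X N.+3] are its parents. The offset leaves [N.+1] nodes
    between the parents, hence at least one. *)
Lemma no_active_cycle_walk (X : nat -> V) (N : nat) :
  acyclic E -> ~ has_active_cycle E -> {in gtn N.+4 &, injective X} ->
  active_walk (X \o S) N.+3 -> E (X 1) (X 0) -> E (X N.+3) (X 0) ->
  (forall i j, i.+1 < j < N.+4 -> adjacent E (X i) (X j) -> i = 0 /\ j = N.+3) ->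
  False.
Proof.
move=> acE no_cyc injX actX E10 EN0 chordX; apply: no_cyc.
exists (X 0), (X 1), (X N.+3), (mkseq (X \o S \o S) N.+1).
have trailX : mkseq (X \o S) N.+3 = X 1 :: rcons (mkseq (X \o S \o S) N.+1) (X N.+3).
  by rewrite mkseq_ends.
have cycX : mkseq X N.+4 = X 0 :: mkseq (X \o S) N.+3.
  by rewrite mkseq_ends [in RHS]mkseqS.
have [? ?] := (active_walkP _ _).2 actX.
rewrite -trailX -cycX; split; split=> //.
- by apply/eqP => /injX; rewrite !inE => /(_ isT (ltnSn _)).
- exact/mkseq_uniqP.
apply: chordless_mkseq => // [i ltN|i j lt_ij /chordX].
  by apply: acyclic_connect.
by case=> // -> ->.
Qed.

(** Take for [k] the first index with a forward arc. Past it, a backward arc after a forward one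
    would be a converging connection. Both [k = 0] and [k = n.+1] would give a directed cycle. *)
Lemma active_walk_turn (X : nat -> V) (n : nat) :
  acyclic E -> active_walk X n.+2 -> E (X 1) (X 0) -> E (X 0) (X n.+1) ->
  exists k, [/\ 0 < k <= n, forall i, i < k -> E (X i.+1) (X i)
                & forall i, k <= i <= n -> E (X i) (X i.+1)].
Proof.
move=> acE [injX adjX ncX] E10 E0n.
(* The disjunct [i == n.+1] makes [P] satisfiable before a forward arc is known to exist. *)
pose P i := (i == n.+1) || E (X i) (X i.+1).
have exP : exists i, P i by exists n.+1; rewrite /P eqxx.
case: (ex_minnP exP) => k Pk mink.
have le_kn1 : k <= n.+1 by apply: mink; rewrite /P eqxx.
have up i : i < k -> E (X i.+1) (X i).
  move=> lt_ik; have /orP[] // := adjX i ltac:(lia).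
  by move=> Ei; suff: k <= i by [lia]; apply: mink; rewrite /P Ei orbT.
have ne_kn1 : k != n.+1.
  apply/eqP => def_k; have: connect E (X n.+1) (X 0).
    by apply: walk_connect_rev => // i; rewrite -def_k; apply: up.
  by move/(acyclic_connect acE); rewrite E0n.
have down i : k <= i <= n -> E (X i) (X i.+1).
  elim: i => [|i IHi] le_i.
    have k0 : k = 0 by lia.
    by move: Pk; rewrite /P (negPf ne_kn1) k0.
  have [eq_k|ne_k] := eqVneq k i.+1.
    by move: Pk; rewrite /P (negPf ne_kn1) eq_k.
  have Ei : E (X i) (X i.+1) by apply: IHi; lia.
  have /orP[//|Ei'] := adjX i.+1 ltac:(lia).
  by have := ncX i ltac:(lia); rewrite /converging Ei Ei'.
exists k; split=> //; case: k {mink} => [|k] in Pk le_kn1 ne_kn1 up down *; last by lia.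
by have := acyclic_connect acE (connect1 E10); rewrite down.
Qed.

(** * Chords of a shortest active trail *)

Section ShortestWalk.

Variables (X : nat -> V) (n : nat).
Hypotheses (acE : acyclic E) (no_cyc : ~ has_active_cycle E).
Hypotheses (actX : active_walk X n.+2) (E10 : E (X 1) (X 0)).
Hypothesis (E0n : E (X 0) (X n.+1)).
Hypothesis minX : forall (Y : nat -> V) (m : nat),
  Y 0 = X 0 -> Y m.+1 = X n.+1 -> active_walk Y m.+2 -> E (Y 1) (Y 0) -> n <= m.

(** Jumping from [X i] to [X j] creates new connections only at these two nodes, and changes the
    first arc only if [i = 0]. If all three spots are harmless, the shorter trail contradicts
    [minX]. *)
Lemma no_active_shortcut (i j : nat) :
  i.+1 < j <= n.+1 -> adjacent E (X i) (X j) ->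
  (0 < i -> ~~ converging E (X i.-1) (X i) (X j)) ->
  (j <= n -> ~~ converging E (X i) (X j) (X j.+1)) ->
  ~ (i = 0 -> E (X j) (X 0)).
Proof.
move=> lt_ij adj_ij nc_i nc_j Ej0; have [injX adjX ncX] := actX.
(* [d] counts the skipped nodes; [f] lists the indices that remain. *)
pose d := j - i.+1; pose f m := if m <= i then m else m + d.
have fle m : m <= i -> f m = m by rewrite /f => ->.
have fgt m : i < m -> f m = m + d by rewrite /f ltnNge => /negPf->.
have fS : f i.+1 = j by rewrite fgt // /d; lia.
suff: n <= n - d by rewrite /d; lia.
apply: (minX (Y := X \o f)) => /=.
- by rewrite fle.
- by rewrite fgt; [congr X; rewrite /d; lia | rewrite /d; lia].
- split=> [p q|p|p]; rewrite ?inE /= => ltp.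
  + move=> ltq /injX; rewrite !inE => eq_f; have: f p = f q.
      by apply: eq_f; rewrite /f /d in ltp ltq *; case: ifP; lia.
    by rewrite /f; case: ifP; case: ifP; lia.
  + have [lt_pi|lt_ip|->] := ltngtP p i; last by rewrite fS fle.
      by rewrite !fle //; [apply: adjX; lia | lia].
    by rewrite !fgt; [apply: adjX; rewrite /d in ltp *; lia | lia..].
  have [lt_p1i|lt_ip1|eq_p1] := ltngtP p.+1 i.
  + by rewrite !fle; [apply: ncX; lia | lia..].
  + have [lt_ip|le_pi] := ltnP i p.
      by rewrite !fgt; [apply: ncX; rewrite /d in ltp *; lia | lia..].
    have -> : p = i by lia.
    rewrite fS fle // (_ : f i.+2 = j.+1); last by rewrite fgt // /d; lia.
    by apply: nc_j; rewrite /d in ltp; lia.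
  rewrite eq_p1 fS !fle; [|lia..].
  by have := nc_i; rewrite -eq_p1; apply.
rewrite (fle 0) //; have [i0|i_gt0] := posnP i; last by rewrite fle.
by rewrite -{1}i0 fS Ej0.
Qed.

(** The tail of the chord cannot be a converging connection. At its head, the trail arc leading away
    from the chord leaves the head: otherwise the trail would contain a directed path from head to
    tail, closing a cycle with the chord. For [i = 0] only a chord into [X 0] keeps the first arc
    admissible. *)
Lemma shortest_walk_chord (i j : nat) :
  i.+1 < j <= n.+1 -> adjacent E (X i) (X j) -> i = 0 /\ E (X 0) (X j).
Proof.
move=> lt_ij adj_ij.
have [k [le_kn up down]] := active_walk_turn acE actX E10 E0n.
have antiE a b : E a b -> ~~ E b a by move/connect1; apply: acyclic_connect.
have shortcut := no_active_shortcut lt_ij adj_ij.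
case/orP: (adj_ij) => Eij.
  have [i0|i_gt0] := posnP i; first by split; rewrite // -i0.
  case: shortcut; last by lia.
    by rewrite /converging negb_and (antiE _ _ Eij) orbT.
  move=> le_jn; rewrite /converging negb_and orbC antiE //.
  apply: down; rewrite le_jn andbT leqNgt; apply/negP => lt_jk.
  have: connect E (X j) (X i).
    by apply: walk_connect_rev => [|m lt_m]; [lia | apply: up; lia].
  by move/(acyclic_connect acE); rewrite Eij.
case: shortcut => [i_gt0|_|<- //].
  rewrite /converging negb_and antiE //.
  have := up i.-1; rewrite prednK //; apply.
  rewrite leqNgt; apply/negP => lt_ki.
  have: connect E (X i) (X j).
    by apply: walk_connect => [|m lt_m]; [lia | apply: down; lia].
  by move/(acyclic_connect acE); rewrite Eij.
by rewrite /converging negb_and antiE.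
Qed.

Lemma shortest_walk_fan_pred (l : nat) :
  2 < l <= n.+1 -> E (X 0) (X l) -> E (X 0) (X l.-1).
Proof.
move=> lt_l E0l.
have [k [le_kn up down]] := active_walk_turn acE actX E10 E0n.
have [injX adjX ncX] := actX.
have antiE a b : E a b -> ~~ E b a by move/connect1; apply: acyclic_connect.
(* Every node up to the turn reaches [X 0] against the indexing, so by acyclicity it is no child of
   [X 0]. *)
have fan_gt m : m <= n.+1 -> E (X 0) (X m) -> k < m.
  move=> le_mn E0m; rewrite ltnNge; apply/negP => le_mk.
  have: connect E (X m) (X 0).
    by apply: walk_connect_rev => [|i lt_i] //; apply: up; lia.
  by move/(acyclic_connect acE); rewrite E0m.
have [//|nE0l1] := boolP (E (X 0) (X l.-1)).
pose P m := (0 < m < l.-1) && adjacent E (X 0) (X m).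
have exP : exists m, P m by exists 1; rewrite /P /adjacent /= E10 orbT andbT; lia.
have ubP m : P m -> m <= l by rewrite /P; lia.
case: (ex_maxnP exP ubP) => j /andP[lt_j adj0j] maxj.
have nadj m : j < m < l -> ~~ adjacent E (X 0) (X m).
  move=> lt_m; apply/negP => adj0m; have [eq_m|ne_m] := eqVneq m l.-1.
    have [|_] := @shortest_walk_chord 0 m _ adj0m; first by lia.
    by rewrite eq_m (negPf nE0l1).
  have: m <= j by apply: maxj; rewrite /P adj0m andbT; lia.
  by lia.
have [N def_l] : exists N, l = j + N.+2 by exists (l - j - 2); lia.
(* The cycle is listed from the common child: [X l], [X 0], [X j], ..., [X l.-1], where
   [l.-1 = j + N.+1]. *)
pose f m := if m is m'.+1 then if m' is p.+1 then j + p else 0 else l.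
have lt_kl : k < l by apply: fan_gt; lia.
have f_bound m : m < N.+4 -> f m < n.+2 by case: m => [|[|m]] /=; lia.
have f_inj p q : p < N.+4 -> q < N.+4 -> f p = f q -> p = q.
  by case: p q => [|[|p]] [|[|q]] /=; lia.
have Xf_inj p q : p < N.+4 -> q < N.+4 -> X (f p) = X (f q) -> p = q.
  move=> ltp ltq /injX eqX; apply: f_inj => //.
  by apply: eqX; rewrite inE f_bound.
exfalso; apply: (@no_active_cycle_walk (X \o f) N) => //=.
- split=> [p q|[|p]|[|p]] /=.
  + by rewrite !inE => ltp ltq /(Xf_inj p.+1 q.+1 ltp ltq)[].
  + by rewrite addn0.
  + by rewrite addnS => ltp; apply: adjX; lia.
  (* The connection at [X j]: if [X 0] is a parent of [X j], then [j] lies past the turn and the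
     next arc leaves [X j]. *)
  + rewrite addn0 addn1 /converging negb_and => _.
    have [E0j|//] := boolP (E (X 0) (X j)).
    by rewrite antiE // down //; have := fan_gt j; lia.
  by rewrite !addnS => ltp; apply: ncX; lia.
- have := down l.-1; rewrite prednK; last by lia.
  by rewrite (_ : j + N.+1 = l.-1); [apply|]; lia.
have Xchord a b : 0 < a -> b <= n.+1 -> a.+1 < b -> ~~ adjacent E (X a) (X b).
  move=> a_gt0 le_bn lt_ab; apply/negP => /shortest_walk_chord[|a0 _]; first by rewrite lt_ab.
  by rewrite a0 in a_gt0.
case=> [|[|p]] [|[|q]] //= lt_pq adj_pq.
- suff: q.+2 = N.+3 by [].
  have [//|ne_q] := eqVneq q.+2 N.+3.
  by move: adj_pq; rewrite adjacent_sym (negPf (Xchord _ _ _ _ _)) //; lia.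
- by move: adj_pq; rewrite (negPf (nadj _ _)) //; lia.
by move: adj_pq; rewrite (negPf (Xchord _ _ _ _ _)) //; lia.
Qed.

Lemma shortest_walk_fan (i : nat) : 2 <= i <= n.+1 -> E (X 0) (X i).
Proof.
(* Descending induction, phrased through the distance to the last index; the base case is [E0n]. *)
move=> lt_i; rewrite -(@subKn i n.+1); last by lia.
have: 2 <= n.+1 - (n.+1 - i) by lia.
elim: (n.+1 - i) => [|d IHd]; first by rewrite subn0.
by rewrite subnS => lt_d; apply: shortest_walk_fan_pred; [lia | apply: IHd; lia].
Qed.

Lemma shortest_walk_step (i : nat) : 0 < i <= n -> E (X i) (X i.+1).
Proof.
move=> lt_i; have [k [le_kn up down]] := active_walk_turn acE actX E10 E0n.
apply: down; suff: k < 2 by lia.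
rewrite ltnNge; apply/negP => le_2k.
have: connect E (X 2) (X 0).
  by apply: walk_connect_rev => // m lt_m; apply: up; lia.
by move/(acyclic_connect acE); rewrite shortest_walk_fan //; lia.
Qed.

End ShortestWalk.

(** * Return to trails given by their interior nodes *)

Lemma seq_walkE (u w : V) (x : seq V) :
  mkseq (nth w (u :: x) \o S) (size x) = x.
Proof. exact: mkseq_nth. Qed.

Lemma active_trail_into_start_both (u w : V) (y : seq V) :
  acyclic E -> E u w -> active_trail_into_start E u w y -> active_trail_into_both E u w y.
Proof.
move=> acE Euw act_y; split=> //; move: act_y.
(* The default value of [nth] supplies the end node [w] at index [(size y).+1]. *)
pose X := nth w (u :: y); rewrite -[y](seq_walkE u w) -/X.
have Xw : X (size y).+1 = w by rewrite /X /= nth_default.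
rewrite -{1}Xw (_ : u = X 0) // => /active_trail_into_start_walk[actX E10].
have [|k [le_kn _ down]] := active_walk_turn acE actX E10; first by rewrite Xw.
have := down (size y); rewrite Xw leqnn andbT seq_walkE => Ew.
rewrite (last_nth w) -/X; apply: Ew; lia.
Qed.

Lemma shortest_active_trail (v1 v2 : V) (x : seq V) :
  acyclic E -> ~ has_active_cycle E -> E v1 v2 ->
  fewest_nodes (active_trail_into_start E v1 v2) x ->
  (forall i : nat, 1 <= i <= size x -> E (nth v2 x i.-1) (nth v2 x i)) /\
  (forall i : nat, 2 <= i <= size x -> E v1 (nth v2 x i.-1)).
Proof.
move=> acE no_cyc E12 [act_x min_x]; pose X := nth v2 (v1 :: x).
have Xw : X (size x).+1 = v2 by rewrite /X /= nth_default.
have [actX E10] : active_walk X (size x).+2 /\ E (X 1) (X 0).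
  by apply/active_trail_into_start_walk; rewrite Xw seq_walkE.
have E0n : E (X 0) (X (size x).+1) by rewrite Xw.
have minX Y m : Y 0 = X 0 -> Y m.+1 = X (size x).+1 -> active_walk Y m.+2 ->
    E (Y 1) (Y 0) -> size x <= m.
  rewrite Xw => Y0 Ym actY EY; rewrite -(size_mkseq (Y \o S) m); apply: min_x.
  by rewrite -Ym -[v1]/(X 0) -Y0; apply/active_trail_into_start_walk.
split=> [[|i] // lt_i|[|i] // lt_i].
  exact: (shortest_walk_step acE no_cyc actX E10 E0n minX lt_i).
by apply: (shortest_walk_fan acE no_cyc actX E10 E0n minX (i := i.+1)); lia.
Qed.

End Walks.

(* The node x_i is [nth v2 x i.-1]; the default value of [nth] implements the
   convention x_{n+1} := v2. *)
Theorem theorem4p10 (V : finType) (E : rel V)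
    (E_acyclic : acyclic E) (E_no_active_cycle : ~ has_active_cycle E)
    (v1 v2 : V) (E_v1v2 : E v1 v2) :
  (forall x : seq V, 1 <= size x ->
     fewest_nodes (active_trail_into_start E v1 v2) x ->
     (forall i : nat, 1 <= i <= size x -> E (nth v2 x i.-1) (nth v2 x i)) /\
     (forall i : nat, 2 <= i <= size x -> E v1 (nth v2 x i.-1)))
  /\
  (forall x : seq V, 1 <= size x ->
     fewest_nodes (active_trail_into_both E v1 v2) x ->
     (forall i : nat, 1 <= i <= size x -> E (nth v2 x i.-1) (nth v2 x i)) /\
     (forall i : nat, 2 <= i <= size x -> E v1 (nth v2 x i.-1))).
Proof.
split=> x _ min_x; first exact: shortest_active_trail.
apply: shortest_active_trail => //; case: min_x => [[act_x _] min_x].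
(* Every competitor in the larger class already ends with an arc into [v2], so minimality carries
   over to that class. *)
by split=> // y /(active_trail_into_start_both E_acyclic E_v1v2) /min_x.
Qed.
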